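(* Let $\mathcal{H}$ be a real Hilbert space, let $A,B:\mathcal{H}\rightrightarrows\mathcal{H}$ be set-valued operators and let $F:\mathcal{H}\to\mathcal{H}$ be single-valued. Then: (i) If $F$ is not constant, then $\mathcal{G}(F,F)=\{1\}$. (ii) $\mathcal{G}(A+F,F)=1+\mathcal{G}(A,F)$. (iii) $\mathcal{G}(F\circ(A+F)^{-1},\mathrm{id})=\mathcal{G}(F,A+F)$. (iv) $\mathcal{G}(A\circ F,B\circ F)\subseteq\mathcal{G}(A,B)$, with equality if $F$ is surjective. (v) If $\mathcal{G}(F,\mathrm{id})\subseteq D(0,L)$ and $\mathcal{G}(A,B)\subseteq D(0,l)$ for some $L,l>0$, then $\mathcal{G}(F\circ A,B)\subseteq D(0,Ll)$. (vi) If $\mathcal{G}(A,F)\subseteq D(0,L)$ and $\mathcal{G}(F,\mathrm{id})\subseteq D(0,l)$ for some $L,l>0$, then $\mathcal{G}(A,\mathrm{id})\subseteq D(0,Ll)$. (vii) If $M$ is a bounded, invertible linear operator on $\mathcal{H}$ and $\mathcal{G}(A,B)\subseteq\mathbb{C}_{\geq0}$, then $\mathcal{G}((M^{-1})^*\circ A,\,M\circ B)\subseteq\mathbb{C}_{\geq0}$.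
   Context: Operators: for $A:\mathcal{H}\rightrightarrows\mathcal{H}$, $\operatorname{gph}A=\{(x,u):u\in A(x)\}$, $\operatorname{dom}A=\{x:A(x)\neq\emptyset\}$, $A^{-1}(u)=\{x:u\in A(x)\}$, $(A\circ B)(x)=\bigcup_{y\in B(x)}A(y)$; sums are pointwise (Minkowski). A single-valued $F:\mathcal{H}\to\mathcal{H}$ is identified with the set-valued operator $x\mapsto\{F(x)\}$. $\mathrm{id}$ is the identity operator; $M^*$ denotes the adjoint of a bounded linear operator $M$. Extended complex plane: $\overline{\mathbb{C}}=\mathbb{C}\cup\{\infty\}$; $1+S=\{1+s:s\in S\cap\mathbb{C}\}\cup\{\infty:\infty\in S\}$ for $S\subseteq\overline{\mathbb{C}}$. $D(c,r)=\{z\in\mathbb{C}:|z-c|\leq r\}$ (not containing $\infty$). $\mathbb{C}_{\geq\alpha}=\{z\in\mathbb{C}:\operatorname{Re}(z)\geq\alpha\}\cup\{\infty\}$. Scaled relative graph of a pair: for $a,b\in\mathcal{H}$ with $b\neq0$ let $z_\pm(a,b)=\frac{\|a\|}{\|b\|}\exp(\pm i\angle(b,a))$ (a complex-conjugate pair), where $\angle(b,a)=\arccos\frac{\langle b,a\rangle}{\|b\|\|a\|}\in[0,\pi]$ if $a\neq0$ and $b\neq0$, and $\angle(b,a)=0$ otherwise. For $A,B:\mathcal{H}\rightrightarrows\mathcal{H}$, $\mathcal{G}(A,B)\subseteq\overline{\mathbb{C}}$ consists of all points $z_\pm(u_A-\bar u_A,u_B-\bar u_B)$ (both signs) with $x,\bar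 x\in\operatorname{dom}A\cap\operatorname{dom}B$, $u_A\in A(x)$, $\bar u_A\in A(\bar x)$, $u_B\in B(x)$, $\bar u_B\in B(\bar x)$ and $u_B\neq\bar u_B$; additionally $\infty\in\mathcal{G}(A,B)$ if and only if there exist $(x,u_A),(\bar x,\bar u_A)\in\operatorname{gph}A$ and $(x,u_B),(\bar x,\bar u_B)\in\operatorname{gph}B$ (possibly $x=\bar x$) with $u_B=\bar u_B$ and $u_A\neq\bar u_A$. *)

(* Defs.v *)
From HB Require Import structures.
From mathcomp Require Import all_boot all_order all_algebra.
From mathcomp Require Import sesquilinear complex.
From mathcomp Require Import all_classical all_reals all_analysis.

Set Implicit Arguments.
Unset Strict Implicit.
Unset Printing Implicit Defensive.

Import Order.TTheory GRing.Theory Num.Theory.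
Import numFieldNormedType.Exports.

Local Open Scope classical_set_scope.
Local Open Scope ring_scope.
Local Open Scope complex_scope.

(* Real Hilbert spaces: complete normed spaces whose norm comes from a
   symmetric positive definite bilinear form. *)
HB.mixin Record NormedModule_hasInner (R : realType) H
    of NormedModule R H := {
  inner : {dot H for (@idfun R)} ;
  inner_norm : forall x : H, inner x x = `|x| ^+ 2
}.

#[short(type="hilbertType")]
HB.structure Definition Hilbert (R : realType) :=
  {H of CompleteNormedModule R H & NormedModule_hasInner R H}.

Section SetValuedOperators.
Variable T : Type.

Definition setop := T -> set T.

Implicit Types A B : setop.

Definition gph A : set (T * T) := [set p | A p.1 p.2].
Definition dom A : set T := [set x | A x !=set0].
Definition op_inv A : setop := fun u => [set x | A x u].
Definition op_comp A B : setop := fun x => \bigcup_(y in B x) A y.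
Definition single (F : T -> T) : setop := fun x => [set F x].

End SetValuedOperators.

Definition op_add (V : zmodType) (A B : setop V) : setop V :=
  fun x => [set u + v | u in A x & v in B x].

Section ExtendedPlane.
Variable R : realType.

(* The extended complex plane; None is the point at infinity. *)
Definition ecomplex := option R[i].

Definition expi (t : R) : R[i] := cos t +i* sin t.

(* c + S, where infinity is sent to infinity *)
Definition translate (c : R[i]) (S : set ecomplex) : set ecomplex :=
  omap (fun z => c + z) @` S.

(* `|z - c| is the modulus as an element of R[i], hence the cast on r *)
Definition disc (c : R[i]) (r : R) : set ecomplex :=
  Some @` [set z | `|z - c| <= r%:C].

Definition half_plane (alpha : R) : set ecomplex :=
  Some @` [set z | alpha <= complex.Re z] `|` [set None].

End ExtendedPlane.

Section ScaledRelativeGraph.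
Variables (R : realType) (H : hilbertType R).

Definition angle (b a : H) : R :=
  if (a != 0) && (b != 0) then acos (inner b a / (`|b| * `|a|)) else 0.

(* s = false gives z_+, s = true gives z_- *)
Definition zpm (s : bool) (a b : H) : R[i] :=
  (`|a| / `|b|)%:C * expi ((-1) ^+ s * angle b a).

Definition srg_finite (A B : setop H) : set (ecomplex R) :=
  [set w | exists x x' uA uA' uB uB' : H,
    [/\ (dom A `&` dom B) x /\ (dom A `&` dom B) x',
        A x uA /\ A x' uA', B x uB /\ B x' uB', uB <> uB' &
        exists s : bool, w = Some (zpm s (uA - uA') (uB - uB'))]].

Definition srg_infinite (A B : setop H) : set (ecomplex R) :=
  [set w | w = None /\ exists x x' uA uA' uB uB' : H,
    [/\ gph A (x, uA) /\ gph A (x', uA'), gph B (x, uB) /\ gph B (x', uB'),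
        uB = uB' & uA <> uA']].

Definition srg (A B : setop H) : set (ecomplex R) :=
  srg_finite A B `|` srg_infinite A B.

Definition bounded_operator (M : H -> H) :=
  exists k : R, forall x, `|M x| <= k * `|x|.

(* For bounded linear M and every y, the z below exists and is unique by the
   Riesz representation theorem; the default value 0 is then irrelevant. *)
Definition adjoint (M : H -> H) : H -> H :=
  fun y => xget 0 [set z | forall x, inner (M x) y = inner x z].

End ScaledRelativeGraph.

(* Main.v *)
(** G(A, B) only depends on the set of increments (u_A - u_A', u_B - u_B'): a
nonzero pair (a, b) contributes z_±(a, b), or infinity when b = 0. Since
  z_±(a, b) = <a, b> / |b|^2 ± i sqrt(|a|^2 |b|^2 - <a, b>^2) / |b|^2,
shifting a by b shifts z_± by 1, containment of G(A, B) in D(0, r) means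
|a| <= r |b|, and containment in the right half plane means <a, b> >= 0, which
the pair of maps M^{-*}, M preserves. For the last point the adjoint of M^{-1}
must exist although M^{-1} is not assumed bounded: M* is bounded below by
Banach-Steinhaus, so its normal equation is solvable by a variational argument,
hence M* is onto, and M* z = y says precisely <M^{-1} w, y> = <w, z>. *)
Require Import Defs.
From HB Require Import structures.
From mathcomp Require Import all_boot all_order all_algebra.
From mathcomp Require Import sesquilinear complex.
From mathcomp Require Import all_classical all_reals all_analysis.
From mathcomp Require Import ring lra.

Set Implicit Arguments.
Unset Strict Implicit.
Unset Printing Implicit Defensive.

Import Order.TTheory GRing.Theory Num.Theory.
Import numFieldNormedType.Exports.

Local Open Scope classical_set_scope.
Local Open Scope ring_scope.
Local Open Scope complex_scope.

(** * Inner product identities and the Cauchy-Schwarz inequality *)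

Section InnerProduct.
Variables (R : realType) (H : hilbertType R).
Implicit Types (x y z : H) (k : R).

Lemma innerC x y : inner x y = inner y x.
Proof. by rewrite hermitian_subproof expr0 mul1r. Qed.

Lemma innerDl x y z : inner (x + y) z = inner x z + inner y z.
Proof. by rewrite linearDl. Qed.

Lemma innerDr x y z : inner x (y + z) = inner x y + inner x z.
Proof. by rewrite linearDr. Qed.

Lemma innerZl k x y : inner (k *: x) y = k * inner x y.
Proof. by rewrite linearZl. Qed.

Lemma innerZr k x y : inner x (k *: y) = k * inner x y.
Proof. by rewrite innerC innerZl innerC. Qed.

Lemma innerNl x y : inner (- x) y = - inner x y.
Proof. by rewrite -scaleN1r innerZl mulN1r. Qed.

Lemma innerNr x y : inner x (- y) = - inner x y.
Proof. by rewrite innerC innerNl innerC. Qed.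

Lemma innerBl x y z : inner (x - y) z = inner x z - inner y z.
Proof. by rewrite innerDl innerNl. Qed.

Lemma innerBr x y z : inner x (y - z) = inner x y - inner x z.
Proof. by rewrite innerDr innerNr. Qed.

Lemma inner0l x : inner 0 x = 0.
Proof. by rewrite -(scale0r 0) innerZl mul0r. Qed.

Lemma inner0r x : inner x 0 = 0.
Proof. by rewrite innerC inner0l. Qed.

Lemma inner_eq0 x : inner x x = 0 -> x = 0.
Proof. by rewrite inner_norm => /eqP; rewrite sqrf_eq0 normr_eq0 => /eqP. Qed.

Lemma sqr_normD x y : `|x + y| ^+ 2 = `|x| ^+ 2 + 2 * inner x y + `|y| ^+ 2.
Proof.
rewrite -!inner_norm !innerDl !innerDr (innerC y x); ring.
Qed.

Lemma inner_CauchySchwarz x y : `|inner x y| <= `|x| * `|y|.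
Proof.
have [->|y0] := eqVneq y 0; first by rewrite inner0r !normr0 mulr0.
have ny : 0 < `|y| ^+ 2 by rewrite exprn_gt0 ?normr_gt0.
(* The vector is [|y|^2] times the component of [x] orthogonal to [y], scaled to avoid a
   division. *)
have : 0 <= `|y| ^+ 2 * `| `|y| ^+ 2 *: x - inner x y *: y| ^+ 2.
  by rewrite mulr_ge0 ?exprn_ge0.
have -> : `|y| ^+ 2 * `| `|y| ^+ 2 *: x - inner x y *: y| ^+ 2
    = (`|y| ^+ 2) ^+ 2 * ((`|x| * `|y|) ^+ 2 - inner x y ^+ 2).
  rewrite -[`|_ - _| ^+ 2]inner_norm !(innerBl, innerBr, innerZl, innerZr).
  by rewrite !inner_norm (innerC y x); ring.
rewrite (pmulr_rge0 _ (exprn_gt0 2 ny)) subr_ge0 => h.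
by rewrite -(@ler_pXn2r _ 2%N) ?nnegrE ?mulr_ge0// real_normK ?num_real.
Qed.

End InnerProduct.

(** * Scaled relative graphs in terms of increments *)

Section Increments.
Variables (R : realType) (H : hilbertType R).
Implicit Types (A B : setop H) (F : H -> H) (a b : H) (s : bool) (r : R).

(** Uses [sin (acos c) = sqrt (1 - c^2)]. For [a = 0] or [b = 0] both sides are 0, as division by 0
    returns 0. *)
Lemma zpmE s a b : zpm s a b = (inner a b / `|b| ^+ 2)
  +i* ((-1) ^+ s * (Num.sqrt ((`|a| * `|b|) ^+ 2 - inner a b ^+ 2) / `|b| ^+ 2)).
Proof.
rewrite /zpm /angle /expi.
have [->|a0] := eqVneq a 0.
  by rewrite inner0l !(normr0, mul0r, expr0n, subrr, sqrtr0, mulr0).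
have [->|b0] := eqVneq b 0.
  by rewrite normr0 expr0n /= invr0 !mulr0 mul0r.
have na : 0 < `|a| by rewrite normr_gt0.
have nb : 0 < `|b| by rewrite normr_gt0.
set c := inner b a / _.
have cB : -1 <= c <= 1.
  rewrite -ler_norml /c normrM normfV (ger0_norm (mulr_ge0 _ _))//.
  by rewrite ler_pdivrMr ?mulr_gt0// mul1r inner_CauchySchwarz.
have cE : cos ((-1) ^+ s * acos c) = c.
  by case: s; rewrite ?expr1 ?expr0 ?mulN1r ?mul1r ?cosN acosK ?in_itv.
have sE : sin ((-1) ^+ s * acos c) = (-1) ^+ s * Num.sqrt (1 - c ^+ 2).
  by case: s {cE}; rewrite ?expr1 ?expr0 ?mulN1r ?mul1r ?sinN sin_acos.
rewrite cE sE; apply/eqP; rewrite eq_complex /= !mul0r addr0 subr0.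
apply/andP; split; apply/eqP.
  by rewrite /c (innerC b a); field; rewrite !lt0r_neq0.
rewrite mulrC -!mulrA; congr (_ * _).
have -> : (`|a| * `|b|) ^+ 2 - inner a b ^+ 2
    = (`|a| * `|b|) ^+ 2 * (1 - c ^+ 2).
  by rewrite /c (innerC b a); field; rewrite !lt0r_neq0.
rewrite sqrtrM ?sqr_ge0// sqrtr_sqr ger0_norm ?mulr_ge0//.
by field; rewrite lt0r_neq0.
Qed.

Lemma Re_zpm s a b : complex.Re (zpm s a b) = inner a b / `|b| ^+ 2.
Proof. by rewrite zpmE. Qed.

Lemma normc_zpm s a b : `|zpm s a b| = (`|a| / `|b|)%:C.
Proof.
rewrite /zpm normrM [`|expi _|]normc_def /= cos2Dsin2 sqrtr1 mulr1.
by rewrite normc_def /= expr0n addr0 sqrtr_sqr ger0_norm ?divr_ge0.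
Qed.

Lemma zpm_diag s b : b != 0 -> zpm s b b = 1.
Proof.
move=> b0; rewrite zpmE inner_norm -expr2 subrr sqrtr0 mul0r mulr0.
by rewrite divff// sqrf_eq0 normr_eq0.
Qed.

Lemma zpm_addl s a b : b != 0 -> zpm s (a + b) b = 1 + zpm s a b.
Proof.
move=> b0; have nb : `|b| != 0 by rewrite normr_eq0.
rewrite !zpmE; apply/eqP; rewrite eq_complex /=; apply/andP; split; apply/eqP.
  by rewrite innerDl inner_norm; field.
rewrite add0r; congr (_ * (Num.sqrt _ / _)).
by rewrite !exprMn sqr_normD innerDl inner_norm; ring.
Qed.

(** Also sends [(0, 0)] to infinity, so that pair has to be excluded wherever [epm] is used. *)
Definition epm s a b : ecomplex R := if b == 0 then None else Some (zpm s a b).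

Definition incr A B a b := exists x x' u u' v v',
  [/\ A x u /\ A x' u', B x v /\ B x' v', a = u - u' & b = v - v'].

(** Merges the finite and infinite branches: nonvanishing of the pair is automatic when [b != 0] and
    is exactly the condition for infinity when [b = 0]. The domain conditions follow from the
    memberships. *)
Lemma srgE A B : srg A B =
  [set w | exists a b s, [/\ incr A B a b, a != 0 \/ b != 0 & w = epm s a b]].
Proof.
apply/seteqP; split => w.
- case.
  + move=> [x [x' [u [u' [v [v' [_ Au Bv nv [s ->]]]]]]]].
    have vv : v - v' != 0 by rewrite subr_eq0; exact/eqP.
    exists (u - u'), (v - v'), s; split; [|by right|by rewrite /epm (negbTE vv)].
    by exists x, x', u, u', v, v'.
  + move=> [-> [x [x' [u [u' [v [v' [Au Bv vv nu]]]]]]]].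
    exists (u - u'), (v - v'), false; split.
    * by exists x, x', u, u', v, v'.
    * by left; rewrite subr_eq0; exact/eqP.
    * by rewrite /epm vv subrr eqxx.
- move=> [a [b [s [[x [x' [u [u' [v [v' [[Au Au'] [Bv Bv'] -> ->]]]]]]]]]]].
  rewrite /epm !subr_eq0; have [vv|nv] := eqVneq v v' => nuv ->.
    right; split=> //; exists x, x', u, u', v, v'; split=> //.
    by case: nuv => // /eqP.
  left; exists x, x', u, u', v, v'; split=> //.
  + by split; split; [exists u|exists v|exists u'|exists v'].
  + exact/eqP.
  + by exists s.
Qed.

(** A disc omits infinity, so containment forces [a = 0] whenever [b = 0], as does the
    inequality. *)
Lemma srg_disc A B r : 0 <= r -> srg A B `<=` disc 0 r <->
  forall a b, incr A B a b -> `|a| <= r * `|b|.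
Proof.
move=> r0; rewrite srgE; split => [AB a b iab|AB w [a [b [s [iab nab ->]]]]].
- have [->|a0] := eqVneq a 0; first by rewrite normr0 mulr_ge0.
  have [z /= + ze] : disc 0 r (epm false a b).
    by apply: AB; exists a, b, false; split=> //; left.
  move: ze; rewrite /epm; case: ifPn => // b0 [->].
  by rewrite subr0 normc_zpm lecR ler_pdivrMr ?normr_gt0.
- have := AB _ _ iab; have [b0|b0] := eqVneq b 0.
    rewrite b0 normr0 mulr0 normr_le0 => /eqP a0.
    by case: nab; rewrite ?a0 ?b0 eqxx.
  move=> ab; rewrite /epm (negbTE b0); exists (zpm s a b) => //=.
  by rewrite subr0 normc_zpm lecR ler_pdivrMr ?normr_gt0.
Qed.

(** The real part of [zpm s a b] has the sign of [inner a b]. Pairs with [b = 0] are unconstrained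
    on both sides, infinity being in the half plane. *)
Lemma srg_half_plane A B : srg A B `<=` half_plane 0 <->
  forall a b, incr A B a b -> 0 <= inner a b.
Proof.
rewrite srgE; split => [AB a b iab|AB w [a [b [s [iab nab ->]]]]].
- have [->|b0] := eqVneq b 0; first by rewrite inner0r.
  have : half_plane 0 (epm false a b).
    by apply: AB; exists a, b, false; split=> //; right.
  rewrite /epm (negbTE b0) => -[[z /= + [ze]]|//].
  by rewrite ze Re_zpm pmulr_lge0// invr_gt0 exprn_gt0 ?normr_gt0.
- rewrite /epm; case: ifPn => [_|b0]; [by right|left].
  exists (zpm s a b) => //; rewrite /mkset Re_zpm divr_ge0 ?exprn_ge0//.
  exact: AB.
Qed.

(** * Identity, sum, composition and Lipschitz rules *)

Lemma srg_eq A B A' B' : (forall a b, incr A B a b <-> incr A' B' a b) ->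
  srg A B = srg A' B'.
Proof.
move=> h; rewrite !srgE; apply/seteqP; split=> w [a [b [s [iab nab ->]]]];
  by exists a, b, s; split=> //; apply/h.
Qed.

Lemma srg_sub A B A' B' : (forall a b, incr A B a b -> incr A' B' a b) ->
  srg A B `<=` srg A' B'.
Proof.
move=> h; rewrite !srgE => w [a [b [s [iab nab ->]]]].
by exists a, b, s; split=> //; apply: h.
Qed.

Lemma srg_single F : (~ exists c, forall x, F x = c) ->
  srg (single F) (single F) = [set Some 1].
Proof.
move=> Fnc; rewrite srgE; apply/seteqP; split => w /=.
- move=> [a [b [s [[x [x' [u [u' [v [v' [[-> ->] [-> ->] -> ->]]]]]]]]]]].
  move=> nab ->; have nF : F x - F x' != 0 by case: nab.
  by rewrite /epm (negbTE nF) zpm_diag.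
- move=> ->; have [x nx] : exists x, F x <> F 0.
    by apply: contrapT => h; apply: Fnc; exists (F 0) => x;
      apply: contrapT => nx; apply: h; exists x.
  have nF : F x - F 0 != 0 by rewrite subr_eq0; exact/eqP.
  exists (F x - F 0), (F x - F 0), false; split; [|by left|].
    by exists x, 0, (F x), (F 0), (F x), (F 0).
  by rewrite /epm (negbTE nF) zpm_diag.
Qed.

(** Since [F] is single-valued, the summand added to [A x] is the very value [F x] of the second
    operator. *)
Lemma incr_add A F a b :
  incr (op_add A (single F)) (single F) (a + b) b <-> incr A (single F) a b.
Proof.
split.
- move=> [x [x' [u [u' [v [v' [[Au Au'] [-> ->] e be]]]]]]].
  case: Au e => u1 Au1 [_ -> <-]; case: Au' => u1' Au1' [_ -> <-] e.
  exists x, x', u1, u1', (F x), (F x'); split=> //.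
  by apply: (addIr b); rewrite /= e be opprD addrACA.
- move=> [x [x' [u [u' [v [v' [[Au Au'] [-> ->] -> ->]]]]]]].
  exists x, x', (u + F x), (u' + F x'), (F x), (F x').
  split=> //; last by rewrite opprD addrACA.
  by split; [exists u => //; exists (F x)|exists u' => //; exists (F x')].
Qed.

Lemma srg_add A F :
  srg (op_add A (single F)) (single F) = translate 1 (srg A (single F)).
Proof.
have epm_addl s a b : epm s (a + b) b = omap (fun z => 1 + z) (epm s a b).
  by rewrite /epm; case: ifPn => //= b0; rewrite zpm_addl.
rewrite !srgE; apply/seteqP; split => w.
- move=> [a [b [s [iab nab ->]]]].
  have ab : a = (a - b) + b by rewrite subrK.
  exists (epm s (a - b) b); last by rewrite -epm_addl -ab.
  exists (a - b), b, s; split=> //; first by apply/incr_add; rewrite -ab.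
  by have [b0|] := eqVneq b 0; [left; case: nab; rewrite b0 ?subr0 ?eqxx|right].
- move=> [_ [a [b [s [iab nab ->]]] <-]]; exists (a + b), b, s; split=> //.
  + exact/incr_add.
  + by have [b0|] := eqVneq b 0; [left; case: nab; rewrite b0 ?addr0 ?eqxx|right].
Qed.

(** Both sides collect increments of the pairs [(F x, v)] with [v] in [A x]; the base point is [v]
    on the left and [x] on the right. *)
Lemma srg_comp_inv A F : srg (op_comp (single F) (op_inv A)) (single idfun)
  = srg (single F) A.
Proof.
apply: srg_eq => a b; split.
- move=> [x [x' [u [u' [v [v' [[[y yx ->] [y' yx' ->]] [-> ->] -> ->]]]]]]].
  by exists y, y', (F y), (F y'), x, x'.
- move=> [x [x' [u [u' [v [v' [[-> ->] [Av Av'] -> ->]]]]]]].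
  exists v, v', (F x), (F x'), v, v'; split=> //.
  by split; [exists x|exists x'].
Qed.

Lemma srg_comp_sub A B F :
  srg (op_comp A (single F)) (op_comp B (single F)) `<=` srg A B.
Proof.
apply: srg_sub => a b.
move=> [x [x' [u [u' [v [v' [[[_ -> Au] [_ -> Au']] [[_ -> Bv] [_ -> Bv']]
  -> ->]]]]]]].
by exists (F x), (F x'), u, u', v, v'.
Qed.

Lemma srg_comp_surj A B F : set_surj [set: H] [set: H] F ->
  srg (op_comp A (single F)) (op_comp B (single F)) = srg A B.
Proof.
move=> Fs; apply/seteqP; split; first exact: srg_comp_sub.
apply: srg_sub => a b.
move=> [x [x' [u [u' [v [v' [[Au Au'] [Bv Bv'] -> ->]]]]]]].
have [[y _ yx] [y' _ yx']] := (Fs x I, Fs x' I).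
exists y, y', u, u', v, v'; split=> //.
  by split; [exists x|exists x'].
by split; [exists x|exists x'].
Qed.

Lemma srg_comp_disc A B F (L l : R) : 0 < L -> 0 < l ->
  srg (single F) (single idfun) `<=` disc 0 L -> srg A B `<=` disc 0 l ->
  srg (op_comp (single F) A) B `<=` disc 0 (L * l).
Proof.
move=> L0 l0 /(srg_disc _ _ (ltW L0)) hF /(srg_disc _ _ (ltW l0)) hAB.
apply/srg_disc; first by rewrite mulr_ge0 ?ltW.
move=> _ b [x [x' [u [u' [v [v' [[[y Ay ->] [y' Ay' ->]] Bv -> ->]]]]]]].
have Fl : `|F y - F y'| <= L * `|y - y'|.
  by apply: hF; exists y, y', (F y), (F y'), y, y'.
rewrite (le_trans Fl)// -mulrA ler_pM2l//.
by apply: hAB; exists x, x', y, y', v, v'.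
Qed.

Lemma srg_trans_disc A F (L l : R) : 0 < L -> 0 < l ->
  srg A (single F) `<=` disc 0 L -> srg (single F) (single idfun) `<=` disc 0 l ->
  srg A (single idfun) `<=` disc 0 (L * l).
Proof.
move=> L0 l0 /(srg_disc _ _ (ltW L0)) hA /(srg_disc _ _ (ltW l0)) hF.
apply/srg_disc; first by rewrite mulr_ge0 ?ltW.
move=> _ b [x [x' [u [u' [v [v' [Au [-> ->] -> ->]]]]]]].
have Al : `|u - u'| <= L * `|F x - F x'|.
  by apply: hA; exists x, x', u, u', (F x), (F x').
rewrite (le_trans Al)// -mulrA ler_pM2l//.
by apply: hF; exists x, x', (F x), (F x'), x, x'.
Qed.

End Increments.

(** * Normal equations and Riesz representation *)

Section HilbertDuality.
Variables (R : realType) (H : hilbertType R).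
Implicit Types (x y z v : H).

(* z is the minimiser of |T z|^2 - 2 g z. *)
Lemma normal_equation_solvable (T : H -> H) (g : H -> R) (C k K : R) :
  linear T -> scalar g -> (forall x, `|x| <= C * `|T x|) ->
  (forall x, `|T x| <= k * `|x|) -> (forall x, `|g x| <= K * `|x|) ->
  exists z, forall v, inner (T z) (T v) = g v.
Proof.
move=> Tlin glin Tlow Tup gup.
have TD u v : T (u + v) = T u + T v.
  by have := Tlin 1 u v; rewrite !scale1r.
have T0 : T 0 = 0 by apply: (addrI (T 0)); rewrite -TD !addr0.
have TZ a u : T (a *: u) = a *: T u.
  by have := Tlin a u 0; rewrite T0 !addr0.
have TB u v : T (u - v) = T u - T v by rewrite TD -scaleN1r TZ scaleN1r.
have gD u v : g (u + v) = g u + g v.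
  by have := glin 1 u v; rewrite /= scale1r mul1r.
have g0 : g 0 = 0 by apply: (addrI (g 0)); rewrite -gD !addr0.
have gZ a u : g (a *: u) = a * g u.
  by have := glin a u 0; rewrite g0 !addr0.
pose J z : R := `|T z| ^+ 2 - 2 * g z.
(* Then [g z <= P |T z|], and completing the square bounds [J] below. Absolute values are taken
   because [K] and [C] carry no sign. *)
pose P : R := `|K| * `|C|.
have Jlow z : - P ^+ 2 <= J z.
  have gz : g z <= P * `|T z|.
    rewrite (le_trans (ler_norm _))// (le_trans (gup z))//.
    rewrite (le_trans (ler_wpM2r _ (ler_norm K)))// -mulrA ler_wpM2l//.
    by rewrite (le_trans (Tlow z))// ler_wpM2r// ler_norm.
  by have := sqr_ge0 (`|T z| - P); rewrite /J; nra.
pose m : R := inf (range J).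
have Jinf : has_inf (range J).
  split; first by exists (J 0), 0.
  by exists (- P ^+ 2) => _ [z _ <-].
have mJ z : m <= J z by apply: ge_inf; [exact: Jinf.2|exists z].
have /choice[z zJ] (n : nat) : exists z, J z < m + n.+1%:R^-1.
  have n0 : 0 < n.+1%:R^-1 :> R by rewrite invr_gt0.
  by have [_ [z _ <-] ?] := inf_adherent n0 Jinf; exists z.
(* Parallelogram identity at the midpoint of two near-minimisers. *)
have zT n p : `|T (z n - z p)| ^+ 2 <= 2 * (n.+1%:R^-1 + p.+1%:R^-1).
  have := mJ (2^-1 *: (z n + z p)).
  have := zJ n; have := zJ p; rewrite /J TB TZ TD gZ gD -!inner_norm.
  rewrite !(innerDl, innerDr, innerNl, innerNr, innerZl, innerZr).
  rewrite (innerC (T (z p)) (T (z n))).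
  by move: (n.+1%:R^-1) (p.+1%:R^-1) => e f; lra.
(* The lower bound on [T] turns closeness of the images into closeness of the points. *)
have zC n p : (n <= p)%N -> `|z n - z p| ^+ 2 <= C ^+ 2 * (4 * n.+1%:R^-1).
  move=> np; set w := z n - z p.
  have : `|w| * `|w| <= C * `|T w| * (C * `|T w|) by apply: ler_pM.
  rewrite mulrACA -!expr2 => /le_trans; apply.
  rewrite ler_wpM2l ?sqr_ge0// (le_trans (zT n p))//.
  have : p.+1%:R^-1 <= n.+1%:R^-1 :> R by rewrite lef_pV2 ?posrE ?ler_nat.
  by move: (n.+1%:R^-1) (p.+1%:R^-1) => e f; lra.
have /cauchy_cvgP/cvg_ex[/= l zl] : cauchy (z @ \oo).
  have C0 : 0 < C ^+ 2 * 4 + 1 by rewrite ltr_wpDl// mulr_ge0// sqr_ge0.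
  apply: cauchy_exP => e e0.
  have e1 : 0 < e ^+ 2 / (C ^+ 2 * 4 + 1) by rewrite divr_gt0// exprn_gt0.
  near \oo => n; exists (z n).
  change (\forall p \near \oo, ball (z n) e (z p)).
  near=> p; rewrite -ball_normE /ball_ /=.
  rewrite -(@ltr_pXn2r _ 2%N) ?nnegrE ?(ltW e0)//.
  apply: (@le_lt_trans _ _ (C ^+ 2 * (4 * n.+1%:R^-1))).
    by apply: zC; near: p; exact: nbhs_infty_ge.
  apply: (@le_lt_trans _ _ ((C ^+ 2 * 4 + 1) * n.+1%:R^-1)).
    by rewrite mulrA ler_wpM2r// lerDl.
  rewrite -ltr_pdivlMl// mulrC; near: n.
  exact: (near_infty_natSinv_lt (PosNum e1)).
exists l => v; pose q : R := `|T v| ^+ 2; pose d n : R := inner (T (z n)) (T v) - g v.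
have q1 : 0 < q + 1 by rewrite ltr_wpDl// sqr_ge0.
(* Approximate first-order condition: moving from [z n] along [v] lowers [J] by less than [1/(n+1)].
   The step [t] nearly minimises the resulting quadratic; [q + 1] replaces [q] in case [T v = 0]. *)
have dn n : d n ^+ 2 <= (q + 1) * n.+1%:R^-1.
  pose t : R := - d n / (q + 1).
  have := mJ (z n + t *: v); have := zJ n.
  rewrite /J TD TZ gD gZ sqr_normD innerZr normrZ exprMn real_normK ?num_real//.
  rewrite -/q => h1 h2.
  have h3 : 0 <= n.+1%:R^-1 + 2 * t * d n + t ^+ 2 * q.
    by move: h1 h2; rewrite /d; move: (n.+1%:R^-1) => e; lra.
  have tq : t * (q + 1) = - d n by rewrite /t divfK// gt_eqF.
  have h4 : 0 <= (q + 1) * (n.+1%:R^-1 + 2 * t * d n + t ^+ 2 * q).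
    by rewrite mulr_ge0// ltW.
  have h5 : (q + 1) * (n.+1%:R^-1 + 2 * t * d n + t ^+ 2 * q)
      = (q + 1) * n.+1%:R^-1 - 2 * d n ^+ 2 + d n ^+ 2 - t ^+ 2 * (q + 1).
    have -> : d n = - (t * (q + 1)) by rewrite tq opprK.
    by ring.
  have h6 : 0 <= t ^+ 2 * (q + 1) by rewrite mulr_ge0 ?sqr_ge0 ?ltW.
  by move: h4; rewrite {}h5; move: (_ * n.+1%:R^-1) => e; lra.
apply/eqP; rewrite -subr_eq0 -normr_le0; apply/ler_addgt0Pr => e e0.
rewrite add0r.
have e1 : 0 < (e / 2) ^+ 2 / (q + 1).
  by rewrite divr_gt0 ?exprn_gt0 ?divr_gt0.
near \oo => n.
(* Each term is at most [e / 2] for large [n]: the first by convergence and the upper bound on [T],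
   the second by [dn]. *)
have -> : inner (T l) (T v) - g v = inner (T (l - z n)) (T v) + d n.
  by rewrite /d TB innerBl; ring.
rewrite (le_trans (ler_normD _ _))// [e]splitr lerD//.
- rewrite (le_trans (inner_CauchySchwarz _ _))//.
  apply: (@le_trans _ _ ((`|k| * `|T v| + 1) * `|l - z n|)).
    rewrite mulrDl mulrAC ler_wpDr// ?mul1r// ler_wpM2r//.
    by rewrite (le_trans (Tup _))// ler_wpM2r// ler_norm.
  have k1 : 0 < `|k| * `|T v| + 1 by rewrite ltr_wpDl// mulr_ge0.
  rewrite -ler_pdivlMl// ltW//; near: n.
  by move/cvgrPdist_lt: zl; apply; rewrite mulr_gt0 ?invr_gt0 ?divr_gt0.
- rewrite -(@ler_pXn2r _ 2%N) ?nnegrE ?divr_ge0 ?(ltW e0)//.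
  rewrite real_normK ?num_real// (le_trans (dn n))//.
  rewrite -ler_pdivlMl// ltW// mulrC; near: n.
  exact: (near_infty_natSinv_lt (PosNum e1)).
Unshelve. all: by end_near. Qed.

Lemma Riesz_representation (g : H -> R) (K : R) : scalar g ->
  (forall x, `|g x| <= K * `|x|) -> exists z, forall v, inner z v = g v.
Proof.
move=> glin gup.
by apply: (@normal_equation_solvable idfun g 1 1 K) => // x; rewrite mul1r.
Qed.

Lemma inner_ext x y : (forall v, inner x v = inner y v) -> x = y.
Proof.
by move=> xy; apply/eqP; rewrite -subr_eq0; apply/eqP/inner_eq0;
  rewrite innerBl xy subrr.
Qed.

(** * The adjoint of a bounded bijection is onto *)

Section BoundedBijection.
Variables (M : {linear H -> H}) (Minv : H -> H).
Hypotheses (Mbnd : bounded_operator M) (MK : cancel M Minv) (MinvK : cancel Minv M).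

Lemma adjoint_exists : exists Ms : H -> H, forall x y, inner (M x) y = inner x (Ms y).
Proof.
have [k Mk] := Mbnd.
have /choice[Ms MsE] y : exists z, forall v, inner z v = inner (M v) y.
  apply: (@Riesz_representation _ (`|k| * `|y|)).
    by move=> a u v /=; rewrite linearP innerDl innerZl.
  move=> x; rewrite (le_trans (inner_CauchySchwarz _ _))// mulrAC ler_wpM2r//.
  by rewrite (le_trans (Mk x))// ler_wpM2r// ler_norm.
by exists Ms => x y; rewrite -MsE innerC.
Qed.

Variable Ms : H -> H.
Hypothesis MsE : forall x y, inner (M x) y = inner x (Ms y).

Lemma adjoint_linear : linear Ms.
Proof.
move=> a u v; apply: inner_ext => x.
by rewrite innerC -MsE innerDr innerZr !MsE innerDl innerZl !(innerC x).
Qed.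

Lemma adjoint_bounded : bounded_operator Ms.
Proof.
have [k Mk] := Mbnd; exists `|k| => z.
have [->|nz] := eqVneq (Ms z) 0; first by rewrite normr0 mulr_ge0.
(* From [|Ms z|^2 = <M (Ms z), z>], one factor [|Ms z|] cancels. *)
rewrite -(@ler_pM2l _ `|Ms z|) ?normr_gt0// -expr2 -inner_norm -MsE.
rewrite (le_trans (ler_norm _))// (le_trans (inner_CauchySchwarz _ _))//.
rewrite mulrA ler_wpM2r// mulrC (le_trans (Mk _))//.
by rewrite ler_wpM2r// ler_norm.
Qed.

(* The functionals <., z> with |Ms z| <= 1 are pointwise bounded, because
   <w, z> = <Minv w, Ms z>; Banach-Steinhaus makes the bound uniform. *)
Lemma adjoint_bounded_below : exists C, forall z, `|z| <= C * `|Ms z|.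
Proof.
pose Fam := [set f : H -> R^o | exists2 z, `|Ms z| <= 1 & f = (inner^~ z)].
have [||C hC] := @Banach_Steinhauss R H R^o Fam _ _ 1.
- move=> _ [z _ ->]; split.
    move=> r; exists (r * `|z|) => x xr.
    by rewrite (le_trans (inner_CauchySchwarz _ _))// ler_wpM2r.
  by move=> a u v; rewrite innerDl innerZl.
- move=> w; exists `|Minv w| => _ [z z1 ->].
  rewrite -[X in inner X _]MinvK MsE (le_trans (inner_CauchySchwarz _ _))//.
  by rewrite ler_piMr.
(* The functional [<., z>] takes the value [|z|] at [z / |z|]. For [z = 0], evaluating at 0 gives
   [0 <= C]. *)
have unit_bound z : `|Ms z| <= 1 -> `|z| <= C.
  move=> z1; have [->|z0] := eqVneq z 0.
    rewrite normr0; have := hC (inner^~ z) _ 0.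
    by rewrite normr0 inner0l normr0; apply => //; exists z.
  have nz : `|z| != 0 by rewrite normr_eq0.
  have := hC (inner^~ z) _ (`|z|^-1 *: z).
  rewrite normrZ normfV normr_id mulVf// innerZl inner_norm expr2 mulKf//.
  by rewrite normr_id; apply => //; exists z.
exists C => z; have [Mz0|Mz0] := eqVneq (Ms z) 0.
  rewrite Mz0 normr0 mulr0; suff -> : z = 0 by rewrite normr0.
  by apply: inner_eq0; rewrite -[X in inner X _]MinvK MsE Mz0 inner0r.
have nM : 0 < `|Ms z| by rewrite normr_gt0.
have MsZ a u : Ms (a *: u) = a *: Ms u.
  by apply: inner_ext => v; rewrite innerC -MsE innerZr MsE innerZl innerC.
have := unit_bound (`|Ms z|^-1 *: z).
rewrite MsZ !normrZ normfV normr_id mulVf ?gt_eqF// => /(_ (lexx _)).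
by rewrite ler_pdivrMl// mulrC.
Qed.

(** The normal equation makes [Ms z - y] orthogonal to the range of [Ms], so [M (Ms z - y) = 0], and
    [M] is injective. *)
Lemma adjoint_surj y : exists z, Ms z = y.
Proof.
have [C MsC] := adjoint_bounded_below; have [k Msk] := adjoint_bounded.
have glin : scalar (fun v => inner (Ms v) y).
  by move=> a u v /=; rewrite adjoint_linear innerDl innerZl.
have gup v : `|inner (Ms v) y| <= k * `|y| * `|v|.
  by rewrite (le_trans (inner_CauchySchwarz _ _))// mulrAC ler_wpM2r.
have [z zE] := normal_equation_solvable adjoint_linear glin MsC Msk gup.
exists z; apply/eqP; rewrite -subr_eq0; apply/eqP.
suff : M (Ms z - y) = 0.
  by move=> /(congr1 Minv); rewrite MK -{1}(linear0 M) MK.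
by apply: inner_ext => v; rewrite inner0l MsE innerBl zE (innerC y) subrr.
Qed.

End BoundedBijection.

(** Shows that [adjoint Minv y] is a genuine adjoint value and not the default of [xget]: any [z]
    with [Ms z = y] is a witness. *)
Lemma inner_adjoint_inv (M : {linear H -> H}) (Minv : H -> H) :
  bounded_operator M -> cancel M Minv -> cancel Minv M ->
  forall w y, inner (Minv w) y = inner w (adjoint Minv y).
Proof.
move=> Mbnd MK MinvK w y.
have [Ms MsE] := adjoint_exists Mbnd.
have [z zy] := adjoint_surj Mbnd MK MinvK MsE y.
rewrite /adjoint; case: xgetP => [_ _ ->//|/(_ z)[]] x /=.
by rewrite -zy -MsE MinvK.
Qed.

End HilbertDuality.

Lemma srg_congruence_half_plane (R : realType) (H : hilbertType R)
    (A B : setop H) (M : {linear H -> H}) (Minv : H -> H) :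
  bounded_operator M -> cancel M Minv -> cancel Minv M ->
  srg A B `<=` half_plane 0 ->
  srg (op_comp (single (adjoint Minv)) A) (op_comp (single M) B)
    `<=` half_plane 0.
Proof.
move=> Mbnd MK MinvK /srg_half_plane hAB; apply/srg_half_plane => a b.
move=> [x [x' [_ [_ [_ [_ [[[u Au ->] [u' Au' ->]] [[v Bv ->] [v' Bv' ->]]
  -> ->]]]]]]].
(* The pairing identity is applied to each adjoint value separately, and [Minv] then cancels [M],
   leaving [<v - v', u - u'>]. *)
rewrite -linearB innerC innerBr -!(inner_adjoint_inv Mbnd MK MinvK) !MK.
rewrite -innerBr innerC.
by apply: hAB; exists x, x', u, u', v, v'.
Qed.

Theorem mainTheorem2 (R : realType) (H : hilbertType R)
    (A B : setop H) (F : H -> H) :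
  ((~ exists c : H, forall x : H, F x = c) ->
     srg (single F) (single F) = [set Some 1])
  /\
  srg (op_add A (single F)) (single F) = translate 1 (srg A (single F))
  /\
  srg (op_comp (single F) (op_inv (op_add A (single F)))) (single idfun)
    = srg (single F) (op_add A (single F))
  /\
  (srg (op_comp A (single F)) (op_comp B (single F)) `<=` srg A B
   /\ (set_surj [set: H] [set: H] F ->
       srg (op_comp A (single F)) (op_comp B (single F)) = srg A B))
  /\
  (forall L l : R, 0 < L -> 0 < l ->
     srg (single F) (single idfun) `<=` disc 0 L ->
     srg A B `<=` disc 0 l ->
     srg (op_comp (single F) A) B `<=` disc 0 (L * l))
  /\
  (forall L l : R, 0 < L -> 0 < l ->
     srg A (single F) `<=` disc 0 L ->
     srg (single F) (single idfun) `<=` disc 0 l ->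
     srg A (single idfun) `<=` disc 0 (L * l))
  /\
  (forall (M : {linear H -> H}) (Minv : H -> H),
     bounded_operator M -> cancel M Minv -> cancel Minv M ->
     srg A B `<=` half_plane 0 ->
     srg (op_comp (single (adjoint Minv)) A) (op_comp (single M) B)
       `<=` half_plane 0).
Proof.
split; first exact: srg_single.
split; first exact: srg_add.
split; first exact: srg_comp_inv.
split; first by split; [exact: srg_comp_sub|exact: srg_comp_surj].
split; first exact: srg_comp_disc.
split; first exact: srg_trans_disc.
exact: srg_congruence_half_plane.
Qed.
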